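(* Let $\{Q_k^{Boltz}\}_{k\ge 0}$ be the (random) iterates of Boltzmann soft Q-learning with constant step size $\alpha\in(0,1)$, parameter $\beta>0$, discount factor $\gamma\in[0,1)$, rewards bounded in absolute value by $1$, initial iterate satisfying $\|Q_0^{Boltz}\|_\infty\le 1$, and i.i.d. sampling of state-action pairs from a distribution $d$ with $d(s,a)>0$ for all $(s,a)\in\mathcal S\times\mathcal A$. Let $Q^*$ be the optimal Q-function. Then for any $k\ge 0$, \[ \mathbb{E}\left[\left\|Q_k^{Boltz}-Q^*\right\|_{\infty}\right] \le \frac{4\alpha\gamma d_{max} |\mathcal{S} \times \mathcal{A}|}{1-\gamma}\, k \rho^{k-1} + \frac{3\sqrt{6}\, \alpha^{1/2} d_{max} \left(\ln (|\mathcal{A}|)+\beta\right) |\mathcal{S} \times \mathcal{A}|^{1/2}}{\beta\, d_{min}^{3/2}(1-\gamma)^{5/2}} + \frac {4 d_{max} \ln(|\mathcal{A}|) |\mathcal{S} \times \mathcal{A}|^{1/2}}{\beta\, d_{min}^2(1-\gamma)^2} + \frac{2 |\mathcal{S} \times \mathcal{A}|}{1-\gamma} \rho^k . \]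
   Context: MDP: finite state space $\mathcal S=\{1,\dots,|\mathcal S|\}$, finite action space $\mathcal A=\{1,\dots,|\mathcal A|\}$, transition probabilities $P(s'|s,a)$, reward function $r:\mathcal S\times\mathcal A\times\mathcal S\to\mathbb R$ with $\max_{s,a,s'}|r(s,a,s')|\le 1$, discount factor $\gamma\in[0,1)$. The optimal Q-function $Q^*\in\mathbb R^{|\mathcal S||\mathcal A|}$ is the unique solution of the Bellman optimality equation $Q^*(s,a)=\sum_{s'}P(s'|s,a)\left(r(s,a,s')+\gamma\max_{u\in\mathcal A}Q^*(s',u)\right)$. Sampling: $d$ is a probability distribution on $\mathcal S\times\mathcal A$ with $d(s,a)>0$ for all $(s,a)$ (for instance $d(s,a)=p(s)\pi_b(a|s)$ for a time-invariant behavior policy $\pi_b$ and stationary state distribution $p$). At each time $k\ge0$, $(s_k,a_k)\sim d$, independently and identically distributed over $k$, then $s_k'\sim P(\cdot|s_k,a_k)$ and $r_k=r(s_k,a_k,s_k')$; the tuples are independent over $k$. Boltzmann operator: for $v\in\mathbb R^{|\mathcal A|}$ and $\beta>0$, $h_{Boltz}^{\beta}(v)=\frac{\sum_{a\in\mathcal A}v(a)\exp(\beta v(a))}{\sum_{u\in\mathcal A}\exp(\beta v(u))}$. Boltzmann soft Q-learning: starting from a fixed (deterministic) $Q_0^{Boltz}$ with $\|Q_0^{Boltz}\|_\infty\le1$, set $Q_{k+1}^{Boltz}(s_k,a_k)=Q_k^{Boltz}(s_k,a_k)+\alpha\{r_k+\gamma h_{Boltz}^\beta(Q_k^{Boltz}(s_k',\cdot))-Q_k^{Boltz}(s_k,a_k)\}$,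 all other entries of $Q_k^{Boltz}$ being unchanged. Constants: $d_{max}=\max_{(s,a)}d(s,a)\in(0,1)$, $d_{min}=\min_{(s,a)}d(s,a)\in(0,1)$, $\rho=1-\alpha d_{min}(1-\gamma)\in(0,1)$; $|\mathcal S\times\mathcal A|=|\mathcal S||\mathcal A|$. *)

(* Defs.v *)
From HB Require Import structures.
From mathcomp Require Import all_boot all_order all_algebra.
From mathcomp Require Import all_classical all_reals all_analysis.

Set Implicit Arguments.
Unset Strict Implicit.
Unset Printing Implicit Defensive.

Import Order.TTheory GRing.Theory Num.Theory.
Import numFieldNormedType.Exports.
Local Open Scope classical_set_scope.
Local Open Scope ring_scope.

(* The state space has n.+1 elements and the action space m.+1 elements: both
   are finite and nonempty. *)
Definition state (n : nat) := 'I_n.+1.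
Definition action (m : nat) := 'I_m.+1.

Record mdp (R : realType) (n m : nat) := Mdp {
  trans : state n -> action m -> state n -> R;   (* trans s a s' = P(s' | s, a) *)
  reward : state n -> action m -> state n -> R;
  trans_ge0 : forall s a s', 0 <= trans s a s';
  trans_sum1 : forall s a, \sum_s' trans s a s' = 1
}.

(* Q-functions are matrices indexed by states and actions. The norm that
   MathComp-Analysis puts on matrices, `|Q|, is the maximum of the absolute
   values of the entries, that is, the infinity norm of Q as a vector. *)
Notation qfun R n m := 'M[R]_(n.+1, m.+1).

Definition maxQ (R : realType) (n m : nat) (Q : qfun R n m) (s : state n) : R :=
  \big[Num.max/Q s ord0]_(u < m.+1) Q s u.

Definition optimal_qfun (R : realType) (n m : nat) (M : mdp R n m) (gamma : R)
    (Q : qfun R n m) : Prop :=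
  forall (s : state n) (a : action m),
    Q s a = \sum_(s' < n.+1) trans M s a s' * (reward M s a s' + gamma * maxQ Q s').

Definition boltzmann (R : realType) (m : nat) (beta : R) (v : action m -> R) : R :=
  (\sum_a v a * expR (beta * v a)) / (\sum_u expR (beta * v u)).

(* A sample (s, a, s') is a state, an action and the next state. *)
Definition sample (n m : nat) : finType := (state n * action m * state n)%type.

Definition boltz_step (R : realType) (n m : nat) (M : mdp R n m)
    (alpha beta gamma : R) (x : sample n m) (Q : qfun R n m) : qfun R n m :=
  let: (sk, ak, sk') := x in
  \matrix_(s, a)
    if (s == sk) && (a == ak) then
      Q s a + alpha * (reward M sk ak sk' + gamma * boltzmann beta (Q sk') - Q s a)
    else Q s a.

(* The k-th iterate, along the sequence x of samples. *)
Fixpoint boltz_iter (R : realType) (n m : nat) (M : mdp R n m)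
    (alpha beta gamma : R) (Q0 : qfun R n m) (x : nat -> sample n m) (k : nat) :
    qfun R n m :=
  if k is j.+1 then
    boltz_step M alpha beta gamma (x j) (boltz_iter M alpha beta gamma Q0 x j)
  else Q0.

Definition sa_distribution (R : realType) (n m : nat)
    (d : state n * action m -> R) : Prop :=
  (forall x, 0 <= d x) /\ \sum_x d x = 1.

Definition dmax (R : realType) (n m : nat) (d : state n * action m -> R) : R :=
  \big[Num.max/d (ord0, ord0)]_x d x.

Definition dmin (R : realType) (n m : nat) (d : state n * action m -> R) : R :=
  \big[Num.min/d (ord0, ord0)]_x d x.

(* Measurability with respect to the discrete sigma-algebra on the finite E. *)
Definition random_elements (disp : measure_display) (T : measurableType disp)
    (E : finType) (X : nat -> T -> E) : Prop :=
  forall (k : nat) (B : set E), measurable (X k @^-1` B).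

Definition mutually_independent (disp : measure_display) (T : measurableType disp)
    (R : realType) (P : probability T R) (E : finType) (X : nat -> T -> E) : Prop :=
  forall (J : seq nat) (B : nat -> set E), uniq J ->
    P (\bigcap_(k in [set` J]) X k @^-1` B k) =
    (\prod_(k <- J) P (X k @^-1` B k))%E.

(* X k = (s_k, a_k, s_k'): the pair (s_k, a_k) has law d; given (s_k, a_k) = (s, a),
   the next state s_k' has law P(. | s, a), written without division by the
   probability of the conditioning event; the triples are independent over k. *)
Definition iid_sampling (disp : measure_display) (T : measurableType disp)
    (R : realType) (P : probability T R) (n m : nat) (M : mdp R n m)
    (d : state n * action m -> R) (X : nat -> T -> sample n m) : Prop :=
  [/\ random_elements X,
      forall k s a, P [set w | (X k w).1 = (s, a)] = (d (s, a))%:E,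
      forall k s a s',
        P [set w | (X k w).1 = (s, a) /\ (X k w).2 = s'] =
        (P [set w | (X k w).1 = (s, a)] * (trans M s a s')%:E)%E &
      mutually_independent P X].

(* Main.v *)
Require Import Defs.
From HB Require Import structures.
From mathcomp Require Import all_boot all_order all_algebra.
From mathcomp Require Import all_classical all_reals all_analysis.
From mathcomp Require Import measurable_realfun ring lra.

(* Let Z solve Z_(j+1) = (1 - alpha d) Z_j + alpha w_j with Z_0 = 0, where w_j is
   the martingale noise of the update. The recursion is diagonal, so the second
   moment of each entry of Z is at most alpha (2 / (1 - gamma))^2, whence
   E |Z_j| <= 2 sqrt(alpha |S x A|) / (1 - gamma). Since the Boltzmann operator
   differs from the maximum by at most ln |A| / beta and the maximum is
   1-Lipschitz, Y = Q - Q* - Z satisfies along every trajectory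
     |Y_(j+1)| <= rho |Y_j| + alpha gamma dmax (ln |A| / beta + |Z_j|).
   Summing the geometric series gives
     E |Q_k - Q*| <= 2 rho^k / (1 - gamma) + gamma dmax ln |A| / (beta dmin (1 - gamma))
                     + 2 sqrt(alpha |S x A|) dmax / (dmin (1 - gamma)^2),
   which is sharper than the claim. *)

Set Implicit Arguments.
Unset Strict Implicit.
Unset Printing Implicit Defensive.

Import Order.TTheory GRing.Theory Num.Theory.
Import numFieldNormedType.Exports.
Local Open Scope classical_set_scope.
Local Open Scope ring_scope.

(** * Averages against a finite probability distribution, with an entropy bound *)

Section WeightedAverage.
Variables (R : realType) (I : finType) (p : I -> R).
Hypothesis p_ge0 : forall i, 0 <= p i.
Hypothesis p_sum1 : \sum_i p i = 1.

Lemma average_cst (c : R) : \sum_i p i * c = c.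
Proof. by rewrite -mulr_suml p_sum1 mul1r. Qed.

Lemma average_le (f : I -> R) (c : R) :
  (forall i, f i <= c) -> \sum_i p i * f i <= c.
Proof.
by move=> fc; rewrite -[leRHS]average_cst; apply: ler_sum => i _; exact: ler_wpM2l.
Qed.

Lemma average_norm_le (f : I -> R) (c : R) :
  (forall i, `|f i| <= c) -> `|\sum_i p i * f i| <= c.
Proof.
move=> fc; apply: le_trans (ler_norm_sum _ _ _) _.
under eq_bigr do rewrite normrM (ger0_norm (p_ge0 _)).
exact: average_le.
Qed.

(* Averages the tangent inequality of exp at ln #|I|; the hypothesis says that
   the p i are the Gibbs weights of the energies u. *)
Lemma gibbs_mean_le_ln (u : I -> R) (S : R) :
  1 <= S -> (forall i, p i = expR (- u i) / S) ->
  \sum_i p i * u i <= ln #|I|%:R.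
Proof.
move=> S1 pE; set L := ln _.
have S0 : 0 < S by rewrite (lt_le_trans ltr01).
have I0 : (0 < #|I|%:R :> R).
  rewrite ltr0n lt0n; apply/eqP => I0.
  suff : \sum_i p i = 0 by rewrite p_sum1 => /eqP; rewrite oner_eq0.
  by apply: big1 => i _; have := fintype0 i I0.
have expL : expR L = #|I|%:R by rewrite lnK.
have tangent i : p i * (1 + (u i - L)) <= (#|I|%:R)^-1.
  have h : expR L * (1 + (u i - L)) <= expR (u i).
    by rewrite -[in leRHS](subrKC L (u i)) expRD ler_pM2l ?expR_gt0// expR_ge1Dx.
  rewrite -(ler_pM2l I0) mulfV ?gt_eqF// -expL mulrCA.
  apply: le_trans (ler_wpM2l (p_ge0 i) h) _.
  (* The Gibbs form of [p i] cancels [expR (u i)] and leaves [1 / S <= 1]. *)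
  by rewrite pE mulrAC -expRD addNr expR0 ler_pdivrMr// mul1r.
have : \sum_i p i * (1 + (u i - L)) <= 1.
  apply: (@le_trans _ _ (\sum_(i in I) (#|I|%:R)^-1)).
    exact: ler_sum.
  by rewrite sumr_const -[X in X <= _]mulr_natl mulfV ?gt_eqF.
under eq_bigr do rewrite mulrDr mulrBr mulr1.
by rewrite big_split sumrB/= p_sum1 average_cst; lra.
Qed.

End WeightedAverage.

(** * The Boltzmann operator as a Gibbs average, compared with the maximum *)

Section Boltzmann.
Variables (R : realType) (m : nat) (beta : R) (v : action m -> R).

Let S := \sum_u expR (beta * v u).
Let p a := expR (beta * v a) / S.

Lemma boltzmann_sum_gt0 : 0 < S.
Proof.
rewrite /S (bigD1 ord0)//= ltr_pwDl ?expR_gt0//.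
by apply: sumr_ge0 => i _; exact: expR_ge0.
Qed.

Let p_ge0 a : 0 <= p a.
Proof. by rewrite divr_ge0 ?expR_ge0 ?ltW ?boltzmann_sum_gt0. Qed.

Let p_sum1 : \sum_a p a = 1.
Proof. by rewrite -mulr_suml mulfV ?gt_eqF ?boltzmann_sum_gt0. Qed.

Lemma boltzmannE : boltzmann beta v = \sum_a p a * v a.
Proof.
by rewrite /boltzmann mulr_suml; apply: eq_bigr => a _; rewrite /p; ring.
Qed.

Lemma boltzmann_norm_le (c : R) :
  (forall a, `|v a| <= c) -> `|boltzmann beta v| <= c.
Proof. by rewrite boltzmannE; exact: average_norm_le. Qed.

Lemma boltzmann_le (c : R) : (forall a, v a <= c) -> boltzmann beta v <= c.
Proof. by rewrite boltzmannE; exact: average_le. Qed.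

(** Times [beta], the gap [v a0 - boltzmann beta v] is the Gibbs average of the energies
    [beta * (v a0 - v a)], which [gibbs_mean_le_ln] controls. *)
Lemma boltzmann_ge (a0 : action m) : 0 < beta -> (forall a, v a <= v a0) ->
  v a0 - ln #|action m|%:R / beta <= boltzmann beta v.
Proof.
move=> b0 va0.
rewrite lerBlDr -lerBlDl ler_pdivlMr//.
set u := fun a => beta * (v a0 - v a).
have -> : (v a0 - boltzmann beta v) * beta = \sum_a p a * u a.
  rewrite boltzmannE -[X in X - _](average_cst p_sum1) -sumrB mulr_suml.
  by apply: eq_bigr => a _; rewrite /u; ring.
have S0 := boltzmann_sum_gt0.
(* Measuring energies from the maximum divides the partition sum by [expR (beta * v a0)]; its term
   at [a0] becomes 1, so the new sum is at least 1. *)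
apply: (gibbs_mean_le_ln p_ge0 p_sum1 (S := S / expR (beta * v a0))).
  rewrite ler_pdivlMr ?expR_gt0// mul1r /S (bigD1 a0)//= lerDl.
  by apply: sumr_ge0 => i _; exact: expR_ge0.
move=> a; rewrite /p /u mulrBr opprB expRB.
by field; rewrite ?gt_eqF ?expR_gt0.
Qed.

End Boltzmann.

(** * The infinity norm of Q-functions and the greedy maximum *)

Section QFun.
Variables (R : realType) (n m : nat).
Implicit Types Q : qfun R n m.

Lemma qfun_norm_leP Q (c : R) :
  reflect (0 <= c /\ forall s a, `|Q s a| <= c) (`|Q| <= c).
Proof.
rewrite /Num.norm/= mx_normrE; apply: (iffP idP) => [/bigmax_leP[c0 h]|[c0 h]].
  by split=> // s a; exact: (h (s, a)).
by apply/bigmax_leP; split => // -[s a] _; exact: h.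
Qed.

Lemma qfun_entry_le Q s a : `|Q s a| <= `|Q|.
Proof. by have /qfun_norm_leP[_] := lexx `|Q|. Qed.

Lemma qfun_norm_le Q (c : R) : (forall s a, `|Q s a| <= c) -> `|Q| <= c.
Proof.
by move=> h; apply/qfun_norm_leP; split => //; exact: le_trans (h ord0 ord0).
Qed.

(** Passes from second moments of single entries to the norm; this is the source of the factor
    [sqrt(|S x A|)]. *)
Lemma qfun_norm_sqr_le Q : `|Q| ^+ 2 <= \sum_(x : state n * action m) Q x.1 x.2 ^+ 2.
Proof.
have S0 : 0 <= \sum_(x : state n * action m) Q x.1 x.2 ^+ 2.
  by apply: sumr_ge0 => x _; exact: sqr_ge0.
rewrite -(sqr_sqrtr S0) lerXn2r ?nnegrE ?sqrtr_ge0//.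
apply: qfun_norm_le => s a; rewrite -sqrtr_sqr ler_wsqrtr//.
rewrite (bigD1 (s, a))//= lerDl.
by apply: sumr_ge0 => x _; exact: sqr_ge0.
Qed.

Lemma maxQ_attained Q s :
  exists2 a, maxQ Q s = Q s a & forall b, Q s b <= maxQ Q s.
Proof.
have le_maxQ b : Q s b <= maxQ Q s by exact: le_bigmax.
suff [a aE] : exists a, maxQ Q s = Q s a by exists a.
rewrite /maxQ; elim/big_ind: _ => [|_ _ [a ->] [b ->]|a _]; first by exists ord0.
  by case: leP => _; [exists b|exists a].
by exists a.
Qed.

(** Adds the Boltzmann bias on the row of [Q] to the 1-Lipschitz bound for the maximum; the latter
    compares [Q] and [Q'] at the maximizers [a] and [b] of the two rows. *)
Lemma boltzmann_maxQ_dist (beta : R) Q Q' s : 0 < beta ->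
  `|boltzmann beta (Q s) - maxQ Q' s| <= ln #|action m|%:R / beta + `|Q - Q'|.
Proof.
move=> b0.
have [a aE a_max] := maxQ_attained Q s; have [b bE b_max] := maxQ_attained Q' s.
have dist c : `|Q s c - Q' s c| <= `|Q - Q'|.
  by have := qfun_entry_le (Q - Q') s c; rewrite !mxE.
have lo : Q s a - ln #|action m|%:R / beta <= boltzmann beta (Q s).
  by apply: boltzmann_ge => // c; rewrite -aE.
have hi : boltzmann beta (Q s) <= Q s a.
  by apply: boltzmann_le => c; rewrite -aE.
have ln0 : 0 <= ln #|action m|%:R / beta.
  by rewrite divr_ge0 ?(ltW b0)// ln_ge0// card_ord ler1n.
have := dist a; have := dist b.
rewrite !ler_norml bE => /andP[b1 b2] /andP[a1 a2].
have := a_max b; have := b_max a; rewrite aE bE => h1 h2.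
by apply/andP; split; lra.
Qed.

End QFun.

(** * One update of the algorithm, split into mean and noise *)

Section SampleDynamics.
Variables (R : realType) (n m : nat) (M : mdp R n m) (d : state n * action m -> R).
Variables (alpha beta gamma : R).
Implicit Types (Q : qfun R n m) (x : sample n m).

Definition sample_weight x := d x.1 * trans M x.1.1 x.1.2 x.2.

Definition td_error x Q :=
  reward M x.1.1 x.1.2 x.2 + gamma * boltzmann beta (Q x.2) - Q x.1.1 x.1.2.

Definition mean_td_error Q s a := \sum_s' trans M s a s' * td_error (s, a, s') Q.

(** The centred increment: the contribution of the sample to the entry [(s, a)] minus its mean under
    [sample_weight]. *)
Definition td_noise x Q s a :=
  ((s, a) == x.1)%:R * td_error x Q - d (s, a) * mean_td_error Q s a.

Lemma boltz_stepE x Q s a : boltz_step M alpha beta gamma x Q s a =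
  Q s a + alpha * (((s, a) == x.1)%:R * td_error x Q).
Proof.
case: x => [[sk ak] sk']; rewrite mxE /td_error/= xpair_eqE.
by case: andP => [[/eqP-> /eqP->]|_]; rewrite ?mul1r// mul0r mulr0 addr0.
Qed.

Lemma sample_sum (F : sample n m -> R) :
  \sum_x sample_weight x * F x =
  \sum_y d y * \sum_s' trans M y.1 y.2 s' * F (y, s').
Proof.
under [RHS]eq_bigr do rewrite mulr_sumr.
rewrite (pair_bigA _ (fun y s' => d y * (trans M y.1 y.2 s' * F (y, s'))))/=.
by apply: eq_bigr => -[y s'] _; rewrite /sample_weight/= mulrA.
Qed.

Lemma sample_weight_ge0 x : (forall y, 0 <= d y) -> 0 <= sample_weight x.
Proof. by move=> d0; rewrite mulr_ge0// trans_ge0. Qed.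

Lemma sample_weight_sum1 : \sum_y d y = 1 -> \sum_x sample_weight x = 1.
Proof.
move=> d1; rewrite -[RHS]d1; under eq_bigr do rewrite -[sample_weight _]mulr1.
rewrite (sample_sum (fun=> 1)); apply: eq_bigr => y _.
by under eq_bigr do rewrite mulr1; rewrite trans_sum1 mulr1.
Qed.

Lemma sample_sum_at s a (G : sample n m -> R) :
  \sum_x sample_weight x * (((s, a) == x.1)%:R * G x) =
  d (s, a) * \sum_s' trans M s a s' * G (s, a, s').
Proof.
rewrite sample_sum (bigD1 (s, a))//= [X in _ + X]big1 ?addr0.
  by congr (_ * _); apply: eq_bigr => s' _; rewrite eqxx mul1r.
move=> y; rewrite eq_sym => /negPf ysa.
by rewrite big1 ?mulr0// => s' _; rewrite ysa mul0r mulr0.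
Qed.

Lemma td_noise_mean Q s a : \sum_y d y = 1 ->
  \sum_x sample_weight x * td_noise x Q s a = 0.
Proof.
move=> d1; under eq_bigr do rewrite /td_noise mulrBr.
rewrite sumrB sample_sum_at average_cst ?subrr//.
exact: sample_weight_sum1.
Qed.

(** A variance is at most the raw second moment, and the indicator of [(s, a)] leaves the factor
    [d (s, a)]. In [noise_iter_sqr_mean] this factor balances the contraction rate. *)
Lemma td_noise_sqr_mean Q s a (C : R) : (forall y, 0 <= d y) -> \sum_y d y = 1 ->
  (forall x, `|td_error x Q| <= C) ->
  \sum_x sample_weight x * td_noise x Q s a ^+ 2 <= d (s, a) * C ^+ 2.
Proof.
move=> d0 d1 hC; set b := d (s, a) * mean_td_error Q s a.
have -> : \sum_x sample_weight x * td_noise x Q s a ^+ 2 =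
    \sum_x sample_weight x * (((s, a) == x.1)%:R * td_error x Q ^+ 2) - b ^+ 2.
  have -> : \sum_x sample_weight x * td_noise x Q s a ^+ 2 =
    \sum_x sample_weight x * (((s, a) == x.1)%:R * td_error x Q ^+ 2)
    - 2 * b * \sum_x sample_weight x * (((s, a) == x.1)%:R * td_error x Q)
    + \sum_x sample_weight x * b ^+ 2.
    rewrite mulr_sumr -sumrB -big_split/=; apply: eq_bigr => x _.
    (* The indicator equals its own square, hence the case analysis before [ring]. *)
    by rewrite /td_noise -/b; case: eqP => _; rewrite ?mulr1n ?mulr0n; ring.
  rewrite (average_cst (sample_weight_sum1 d1)).
  rewrite (sample_sum_at s a (fun x => td_error x Q)).
  by rewrite -/(mean_td_error Q s a) -/b; ring.
rewrite sample_sum_at lerBlDr ler_wpDr ?sqr_ge0// ler_wpM2l//.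
apply: average_le => [s'||s']; [exact: trans_ge0|exact: trans_sum1|].
by rewrite -real_normK ?num_real// lerXn2r ?nnegrE// (le_trans _ (hC (s, a, s'))).
Qed.

Lemma td_error_norm_le x Q (B : R) : 0 <= gamma ->
  (forall s a s', `|reward M s a s'| <= 1) -> `|Q| <= B ->
  `|td_error x Q| <= 1 + gamma * B + B.
Proof.
move=> g0 hr QB.
have QB' s a : `|Q s a| <= B by exact: le_trans (qfun_entry_le _ _ _) QB.
rewrite (le_trans (ler_normB _ _))// lerD// (le_trans (ler_normD _ _))//.
by rewrite lerD// normrM (ger0_norm g0) ler_wpM2l// boltzmann_norm_le.
Qed.

(** The updated entry is a convex combination of the old entry and the target, and
    [1 + gamma * B <= B] keeps the target within [B]. *)
Lemma boltz_step_norm_le x Q (B : R) : 0 <= alpha <= 1 -> 0 <= gamma ->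
  (forall s a s', `|reward M s a s'| <= 1) -> 1 + gamma * B <= B ->
  `|Q| <= B -> `|boltz_step M alpha beta gamma x Q| <= B.
Proof.
move=> /andP[a0 a1] g0 hr hB QB.
have QB' s a : `|Q s a| <= B by exact: le_trans (qfun_entry_le _ _ _) QB.
apply: qfun_norm_le => s a; rewrite boltz_stepE.
case: eqP => [sax|_]; last by rewrite mul0r mulr0 addr0.
set t := reward M x.1.1 x.1.2 x.2 + gamma * boltzmann beta (Q x.2).
have tB : `|t| <= B.
  apply: le_trans hB; rewrite (le_trans (ler_normD _ _))//.
  by rewrite lerD// normrM (ger0_norm g0) ler_wpM2l// boltzmann_norm_le.
have -> : Q s a + alpha * (1 * td_error x Q) = (1 - alpha) * Q s a + alpha * t.
  by rewrite /td_error -sax/= -/t /t -sax/=; ring.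
rewrite (le_trans (ler_normD _ _))// !normrM (ger0_norm a0) ger0_norm ?subr_ge0//.
have -> : B = (1 - alpha) * B + alpha * B by ring.
by rewrite lerD// ler_wpM2l// subr_ge0.
Qed.

Variable Q0 : qfun R n m.
Local Notation iter := (boltz_iter M alpha beta gamma Q0).

(* The part of the iterates that is driven by the martingale noise alone. *)
Fixpoint noise_iter (x : nat -> sample n m) (k : nat) : qfun R n m :=
  if k is j.+1 then
    \matrix_(s, a) ((1 - alpha * d (s, a)) * noise_iter x j s a
                    + alpha * td_noise (x j) (iter x j) s a)
  else 0.

(** Dependence on the first [k] samples alone is what reduces expectations over trajectories to
    averages over [k]-tuples. *)
Lemma eq_boltz_iter (x y : nat -> sample n m) k :
  (forall i, (i < k)%N -> x i = y i) -> iter x k = iter y k.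
Proof.
elim: k => //= k IH xy; rewrite xy// IH// => i ik.
by rewrite xy// ltnS ltnW.
Qed.

Lemma eq_noise_iter (x y : nat -> sample n m) k :
  (forall i, (i < k)%N -> x i = y i) -> noise_iter x k = noise_iter y k.
Proof.
elim: k => //= k IH xy.
have xy' i : (i < k)%N -> x i = y i by move=> ik; rewrite xy// ltnS ltnW.
by rewrite xy// IH// (eq_boltz_iter xy').
Qed.

Lemma boltz_iter_norm_le (B : R) (x : nat -> sample n m) k : 0 <= alpha <= 1 -> 0 <= gamma ->
  (forall s a s', `|reward M s a s'| <= 1) -> 1 + gamma * B <= B ->
  `|Q0| <= B -> `|iter x k| <= B.
Proof. by move=> a01 g0 hr hB Q0B; elim: k => //= k; exact: boltz_step_norm_le. Qed.

(** The process [Y = Q - Q* - Z]; the fresh sample [x k] cancels from its recursion, so it can be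
    bounded along each trajectory. *)
Definition denoised_error (Qs : qfun R n m) (x : nat -> sample n m) k :=
  iter x k - Qs - noise_iter x k.

Lemma denoised_error_step (Qs : qfun R n m) (x : nat -> sample n m) k :
  0 <= alpha <= 1 -> 0 <= gamma <= 1 -> 0 < beta -> (forall y, 0 <= d y) ->
  (forall y, d y <= 1) -> optimal_qfun M gamma Qs ->
  `|denoised_error Qs x k.+1| <=
    (1 - alpha * dmin d * (1 - gamma)) * `|denoised_error Qs x k| +
    alpha * dmax d * gamma * (ln #|action m|%:R / beta + `|noise_iter x k|).
Proof.
move=> /andP[a0 a1] /andP[g0 g1] b0 d0 d1 hQs; rewrite /denoised_error.
set Q := iter x k; set Z := noise_iter x k.
set c := ln _ / beta + `|Z|; set e := `|Q - Qs - Z|.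
have c0 : 0 <= c.
  by rewrite addr_ge0// divr_ge0 ?(ltW b0)// ln_ge0// card_ord ler1n.
apply: qfun_norm_le => s a; rewrite !mxE boltz_stepE -/Q -/Z.
set D := d (s, a); have D0 : 0 <= D by exact: d0.
have D1 : D <= 1 by exact: d1.
set g := \sum_s' trans M s a s' * (boltzmann beta (Q s') - maxQ Qs s').
(* Subtracting the Bellman equation for [Qs] isolates [g], the mean gap between the Boltzmann value
   of [Q] and the maximum of [Qs]. *)
have mean_tdE : mean_td_error Q s a = Qs s a + gamma * g - Q s a.
  rewrite hQs -[X in _ - X](average_cst (trans_sum1 M s a)) /g mulr_sumr.
  rewrite -big_split/= -sumrB; apply: eq_bigr => s' _.
  by rewrite /td_error/=; ring.
have gle : `|g| <= c + e.
  apply: average_norm_le => [s'||s']; [exact: trans_ge0|exact: trans_sum1|].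
  apply: le_trans (boltzmann_maxQ_dist _ _ _ b0) _.
  rewrite -addrA lerD2l /e.
  (* Splitting [Q - Qs] into noise and denoised error produces the two terms [|Z|] and [e]. *)
  by rewrite -[leLHS](_ : `|Z + (Q - Qs - Z)| = _) ?ler_normD// addrC subrK.
have yle : `|(Q - Qs - Z) s a| <= e by exact: qfun_entry_le.
set y := (Q - Qs - Z) s a in yle.
rewrite /td_noise mean_tdE -/D.
have -> : Q s a + alpha * (((s, a) == (x k).1)%:R * td_error (x k) Q) + - Qs s a +
    - ((1 - alpha * D) * Z s a +
     alpha * (((s, a) == (x k).1)%:R * td_error (x k) Q -
              D * (Qs s a + gamma * g - Q s a))) =
    (1 - alpha * D) * y + alpha * D * gamma * g.
  by rewrite /y !mxE; ring.
have aD1 : 0 <= 1 - alpha * D.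
  by rewrite subr_ge0 mulr_ile1.
apply: le_trans (ler_normD _ _) _; rewrite !normrM (ger0_norm aD1).
rewrite (ger0_norm a0) (ger0_norm D0) (ger0_norm g0).
have e0 : 0 <= e by exact: normr_ge0.
have Dmin : dmin d <= D by exact: bigmin_le.
have Dmax : D <= dmax d by exact: le_bigmax.
(* After [h1] and [h2] the bound is [(1 - alpha * D * (1 - gamma)) * e + alpha * D * gamma * c];
   [h4] replaces [D] by [dmin d] in the first coefficient and [h3] by [dmax d] in the second. *)
have h1 := ler_wpM2l aD1 yle.
have h2 : alpha * D * gamma * `|g| <= alpha * D * gamma * (c + e).
  by rewrite ler_wpM2l ?mulr_ge0.
have h3 : alpha * gamma * c * D <= alpha * gamma * c * dmax d.
  by rewrite ler_wpM2l ?mulr_ge0.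
have h4 : alpha * (1 - gamma) * e * dmin d <= alpha * (1 - gamma) * e * D.
  by rewrite ler_wpM2l ?mulr_ge0// subr_ge0.
lra.
Qed.

End SampleDynamics.

(** * Expectation over [k] independent samples as a finite sum *)

Section TupleAverage.
Variables (R : realType) (E : finType) (p : E -> R).

(** Taking [f] on all sequences, not on [k]-tuples, lets one function serve for every [k] in
    inductions that append a sample. *)
Definition tuple_avg k (f : seq E -> R) :=
  \sum_(t : k.-tuple E) (\prod_(x <- t) p x) * f t.

Lemma tuple_avg0 (f : seq E -> R) : tuple_avg 0 f = f [::].
Proof.
rewrite /tuple_avg (bigD1 [tuple])//= big_nil mul1r big1 ?addr0// => t.
by rewrite (tuple0 t) => /eqP.
Qed.

(** Conditioning on the first [k] samples: the last one is averaged out first, which lets the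
    centring of the noise act inside the average. *)
Lemma tuple_avgS k (f : seq E -> R) :
  tuple_avg k.+1 f = tuple_avg k (fun s => \sum_x p x * f (rcons s x)).
Proof.
rewrite /tuple_avg.
under [RHS]eq_bigr do rewrite mulr_sumr.
rewrite pair_bigA/=.
rewrite (reindex (fun q : k.-tuple E * E => rcons_tuple q.1 q.2))/=.
  by apply: eq_bigr => -[t x] _ /=; rewrite -cats1 big_cat big_seq1/= mulrA.
apply/onW_bij/inj_card_bij => [[t x] [u y] /(congr1 val)/= /rcons_inj[tu ->]|].
  by congr pair; exact: val_inj.
by rewrite card_prod !card_tuple expnSr.
Qed.

Lemma tuple_avg_sum k (I : finType) (f : I -> seq E -> R) :
  tuple_avg k (fun s => \sum_i f i s) = \sum_i tuple_avg k (f i).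
Proof.
rewrite /tuple_avg exchange_big/=; apply: eq_bigr => t _.
by rewrite mulr_sumr.
Qed.

Lemma tuple_avgD k (f g : seq E -> R) :
  tuple_avg k (fun s => f s + g s) = tuple_avg k f + tuple_avg k g.
Proof. by rewrite -big_split; apply: eq_bigr => t _; rewrite mulrDr. Qed.

Lemma tuple_avgZ k (c : R) (f : seq E -> R) :
  tuple_avg k (fun s => c * f s) = c * tuple_avg k f.
Proof. by rewrite mulr_sumr; apply: eq_bigr => t _; rewrite mulrCA. Qed.

Hypothesis p_ge0 : forall x, 0 <= p x.

Lemma le_tuple_avg k (f g : seq E -> R) :
  (forall s, size s = k -> f s <= g s) -> tuple_avg k f <= tuple_avg k g.
Proof.
move=> fg; apply: ler_sum => t _; rewrite ler_wpM2l ?fg ?size_tuple//.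
by apply: prodr_ge0.
Qed.

Hypothesis p_sum1 : \sum_x p x = 1.

Lemma tuple_avg_cst k (c : R) : tuple_avg k (fun=> c) = c.
Proof.
elim: k => [|k IH]; first exact: tuple_avg0.
by rewrite tuple_avgS (average_cst p_sum1).
Qed.

End TupleAverage.

(** * From the probability space to finite averages *)

Section TupleLaw.
Variables (disp : measure_display) (T : measurableType disp) (R : realType).
Variables (P : probability T R) (E : finType) (p : E -> R) (x0 : E).
Variable X : nat -> T -> E.
Hypothesis mX : random_elements X.
Hypothesis lawX : forall k x, P (X k @^-1` [set x]) = (p x)%:E.
Hypothesis indepX : mutually_independent P X.

Let event k (t : seq E) := [set w | mkseq (X^~ w) k = t].

(** An intersection over times is the form that [mutually_independent] speaks of; the default [x0]
    is never reached, since [i < k]. *)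
Let eventE k (t : k.-tuple E) :
  event k t = \bigcap_(i in [set` iota 0 k]) X i @^-1` [set nth x0 t i].
Proof.
apply/seteqP; split => w /=.
  by move=> <- i /=; rewrite mem_iota/= => ik; rewrite nth_mkseq.
move=> h; apply: (@eq_from_nth _ x0); rewrite size_mkseq ?size_tuple// => i ik.
by rewrite nth_mkseq//; apply: h; rewrite /= mem_iota.
Qed.

Let measurable_event k (t : k.-tuple E) : measurable (event k t).
Proof. by rewrite eventE; apply: bigcap_measurableType => i _; exact: mX. Qed.

Lemma tuple_law k (t : k.-tuple E) :
  P [set w | mkseq (X^~ w) k = t] = (\prod_(x <- t) p x)%:E.
Proof.
rewrite -/(event k t) eventE indepX ?iota_uniq//.
rewrite (eq_bigr (fun i => (p (nth x0 t i))%:E)) => [|i _]; last exact: lawX.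
by rewrite prodEFin (big_nth x0) size_tuple /index_iota subn0.
Qed.

(** The integrand is a finite sum of values [f t] times indicators of [event k t]; since [f] is
    nonnegative, sum and integral commute without an integrability condition. *)
Lemma expectation_tuple k (f : seq E -> R) : (forall s, 0 <= f s) ->
  ('E_P[fun w => f (mkseq (X^~ w) k)] = (tuple_avg p k f)%:E)%E.
Proof.
move=> f0; rewrite unlock.
transitivity (\int[P]_w
    \sum_(t : k.-tuple E) (f t)%:E * (\1_(event k t) w)%:E)%E.
  apply: eq_integral => w _.
  have sz : size (mkseq (X^~ w) k) == k by rewrite size_mkseq.
  rewrite (bigD1 (Tuple sz))//= big1 ?adde0 => [|t].
    by rewrite indicE mem_set//= mule1.
  move=> tw; rewrite indicE memNset ?mule0// => /= tE.
  by move/eqP: tw; apply; apply: val_inj => /=.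
rewrite ge0_integral_sum//; last 2 first.
- move=> t; apply: measurable_funeM; apply/measurable_EFinP.
  exact: measurable_indic.
- by move=> t w _; rewrite mule_ge0 ?lee_fin.
rewrite /tuple_avg -sumEFin; apply: eq_bigr => t _.
rewrite ge0_integralZl_EFin//; last first.
  by apply/measurable_EFinP; exact: measurable_indic.
by rewrite integral_indic// setIT EFinM muleC; congr (_ * _)%E; exact: tuple_law.
Qed.

End TupleLaw.

(** * Mean bounds for the noise, the denoised error and the iterates *)

Section MeanError.
Variables (R : realType) (n m : nat) (M : mdp R n m) (d : state n * action m -> R).
Variables (alpha beta gamma : R) (Q0 Qs : qfun R n m) (x0 : sample n m).
Hypothesis reward_le1 : forall s a s', `|reward M s a s'| <= 1.
Hypothesis gamma01 : 0 <= gamma < 1.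
Hypothesis alpha01 : 0 < alpha < 1.
Hypothesis beta_gt0 : 0 < beta.
Hypothesis d_gt0 : forall y, 0 < d y.
Hypothesis d_sum1 : \sum_y d y = 1.
Hypothesis Q0_le1 : `|Q0| <= 1.
Hypothesis Qs_opt : optimal_qfun M gamma Qs.

Local Notation avg := (tuple_avg (sample_weight M d)).
Local Notation iter s := (boltz_iter M alpha beta gamma Q0 (nth x0 s)).
Local Notation noise s := (noise_iter M d alpha beta gamma Q0 (nth x0 s)).
Local Notation denoised s := (denoised_error M d alpha beta gamma Q0 Qs (nth x0 s)).
Local Notation N := (#|{: state n * action m}|%:R : R).
Local Notation L := (ln #|action m|%:R / beta : R).
Local Notation rho := (1 - alpha * dmin d * (1 - gamma)).

Let alpha_gt0 : 0 < alpha. Proof. by case/andP: alpha01. Qed.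
Let alpha_le1 : alpha <= 1. Proof. by case/andP: alpha01 => _ /ltW. Qed.
Let alphaW : 0 <= alpha <= 1. Proof. by rewrite (ltW alpha_gt0) alpha_le1. Qed.
Let gamma_ge0 : 0 <= gamma. Proof. by case/andP: gamma01. Qed.
Let gammaW : 0 <= gamma <= 1. Proof. by case/andP: gamma01 => -> /ltW. Qed.
Let gamma_lt1 : 0 < 1 - gamma. Proof. by rewrite subr_gt0; case/andP: gamma01. Qed.
Let d_ge0 y : 0 <= d y. Proof. exact: ltW. Qed.
Let d_le1 y : d y <= 1.
Proof. by rewrite -d_sum1 (bigD1 y)//= lerDl sumr_ge0. Qed.
Let weight_ge0 x : 0 <= sample_weight M d x.
Proof. exact: sample_weight_ge0. Qed.
Let weight_sum1 : \sum_x sample_weight M d x = 1.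
Proof. exact: sample_weight_sum1. Qed.

Lemma dmin_gt0 : 0 < dmin d.
Proof. by rewrite /dmin; elim/big_ind: _ => // a b a0 b0; rewrite lt_min a0. Qed.

Lemma dmin_le1 : dmin d <= 1.
Proof. by apply: le_trans (d_le1 (ord0, ord0)); exact: bigmin_le. Qed.

Lemma dmin_le_dmax : dmin d <= dmax d.
Proof.
apply: (@le_trans _ _ (d (ord0, ord0))); [exact: bigmin_le|exact: le_bigmax].
Qed.

Lemma rho_ge0 : 0 <= rho.
Proof.
rewrite subr_ge0 mulr_ile1 ?mulr_ge0 ?(ltW dmin_gt0) ?(ltW gamma_lt1) ?(ltW alpha_gt0)//.
  by rewrite mulr_ile1 ?dmin_le1 ?(ltW dmin_gt0) ?(ltW alpha_gt0).
by rewrite gerBl.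
Qed.

(** The Bellman equation gives [|Qs| <= 1 + gamma * |Qs|], which is solved for [|Qs|]. *)
Lemma optimal_qfun_norm_le : `|Qs| <= (1 - gamma)^-1.
Proof.
rewrite -[leRHS]mul1r ler_pdivlMr// mulrBr mulr1 lerBlDr.
apply: qfun_norm_le => s a; rewrite Qs_opt.
apply: average_norm_le => [s'||s']; [exact: trans_ge0|exact: trans_sum1|].
rewrite (le_trans (ler_normD _ _))// lerD// normrM (ger0_norm gamma_ge0) mulrC.
by rewrite ler_wpM2r//; have [b -> _] := maxQ_attained Qs s'; exact: qfun_entry_le.
Qed.

(** The radius [B = 1 / (1 - gamma)] solves [1 + gamma * B = B], so the ball is invariant. By the
    same equation the temporal difference is at most [2 * B]. *)
Lemma boltz_iter_le s k : `|iter s k| <= (1 - gamma)^-1.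
Proof.
apply: boltz_iter_norm_le => //.
  by rewrite le_eqVlt; apply/orP; left; apply/eqP; field; rewrite gt_eqF.
by rewrite (le_trans Q0_le1)// invf_ge1// gerBl.
Qed.

Lemma td_error_iter_le s k x : `|td_error M beta gamma x (iter s k)| <= 2 / (1 - gamma).
Proof.
apply: le_trans (td_error_norm_le beta x gamma_ge0 reward_le1 (boltz_iter_le s k)) _.
by rewrite le_eqVlt; apply/orP; left; apply/eqP; field; rewrite gt_eqF.
Qed.

Let rcons_nth (s : seq (sample n m)) x k : size s = k ->
  forall i, (i < k)%N -> nth x0 (rcons s x) i = nth x0 s i.
Proof. by move=> sk i ik; rewrite nth_rcons sk ik. Qed.

(** The cross term has mean zero given the past, so second moments obey [v' <= l ^+ 2 * v + alpha ^+
    2 * D * C ^+ 2] with [l = 1 - alpha * D]. The value [alpha * C ^+ 2] survives a step because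
    [l ^+ 2 + alpha * D <= 1]. *)
Lemma noise_iter_sqr_mean k s a :
  avg k (fun t => noise t k s a ^+ 2) <= alpha * (2 / (1 - gamma)) ^+ 2.
Proof.
set C := 2 / _; set D := d (s, a).
elim: k => [|k IH].
  by rewrite tuple_avg0/= mxE expr0n/= mulr_ge0// ?sqr_ge0// ltW.
rewrite tuple_avgS.
pose l : R := 1 - alpha * D.
apply: (@le_trans _ _ (avg k (fun t => l ^+ 2 * noise t k s a ^+ 2 +
                                       alpha ^+ 2 * (D * C ^+ 2)))).
  apply: le_tuple_avg => // t tk.
  (* In [rcons t x] the samples before time [k] are those of [t], and the one at time [k] is [x]. *)
  under eq_bigr => x _.
    rewrite /= mxE (eq_noise_iter _ _ _ _ _ _ (rcons_nth x tk)).
    rewrite (eq_boltz_iter _ _ _ _ _ (rcons_nth x tk)) nth_rcons tk ltnn eqxx.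
    rewrite -/D -/l; over.
  set z := noise t k s a; set w := fun x => td_noise M d beta gamma x (iter t k) s a.
  have -> : \sum_x sample_weight M d x * (l * z + alpha * w x) ^+ 2 =
      \sum_x sample_weight M d x * (l * z) ^+ 2 +
      2 * (l * z * alpha) * (\sum_x sample_weight M d x * w x) +
      alpha ^+ 2 * \sum_x sample_weight M d x * w x ^+ 2.
    by rewrite !mulr_sumr -!big_split/=; apply: eq_bigr => x _; ring.
  rewrite td_noise_mean// mulr0 addr0 (average_cst weight_sum1) exprMn lerD2l.
  rewrite ler_wpM2l ?sqr_ge0// td_noise_sqr_mean// => x.
  exact: td_error_iter_le.
rewrite tuple_avgD tuple_avgZ tuple_avg_cst//.
have h := ler_wpM2l (sqr_ge0 l) IH.
apply: (@le_trans _ _ (l ^+ 2 * (alpha * C ^+ 2) + alpha ^+ 2 * (D * C ^+ 2))).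
  by rewrite lerD2r; exact: h.
have -> : l ^+ 2 * (alpha * C ^+ 2) + alpha ^+ 2 * (D * C ^+ 2) =
    alpha * C ^+ 2 - (alpha * C) ^+ 2 * D * (1 - alpha * D) by rewrite /l; ring.
have aD : alpha * D <= 1.
  by apply: mulr_ile1; [exact: ltW|exact: d_ge0| |exact: d_le1].
rewrite gerBl; apply: mulr_ge0; last by rewrite subr_ge0.
by rewrite mulr_ge0 ?sqr_ge0 ?d_ge0.
Qed.

Lemma noise_iter_mean k :
  avg k (fun t => `|noise t k|) <= 2 * Num.sqrt alpha * Num.sqrt N / (1 - gamma).
Proof.
set c := (X in _ <= X).
have N0 : 0 < N by rewrite ltr0n; apply/card_gt0P; exists (ord0, ord0).
have c0 : 0 < c by rewrite !mulr_gt0 ?invr_gt0 ?sqrtr_gt0.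
(* The square of [c] is the entrywise second-moment bound summed over the [N] entries. *)
have c2 : c ^+ 2 = N * (alpha * (2 / (1 - gamma)) ^+ 2).
  rewrite /c !exprMn !sqr_sqrtr ?(ltW N0) ?(ltW alpha_gt0)//; ring.
(* Averaging 2 c |Z| <= |Z|^2 + c^2 spares Jensen's inequality. *)
have : 2 * c * avg k (fun t => `|noise t k|) <= c ^+ 2 + c ^+ 2.
  rewrite -tuple_avgZ [X in _ + X]c2.
  apply: (@le_trans _ _ (avg k (fun t => c ^+ 2 +
      \sum_(y : state n * action m) noise t k y.1 y.2 ^+ 2))).
    apply: le_tuple_avg => // t _.
    have := sqr_ge0 (c - `|noise t k|); have := qfun_norm_sqr_le (noise t k).
    rewrite sqrrB => h1 h2; rewrite -subr_ge0; lra.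
  rewrite tuple_avgD tuple_avg_cst// tuple_avg_sum lerD2l mulr_natl -sumr_const.
  by apply: ler_sum => y _; exact: noise_iter_sqr_mean.
have <- : 2 * c * c = c ^+ 2 + c ^+ 2 by ring.
have c20 : 0 < 2 * c by exact: mulr_gt0.
by rewrite ler_pM2l.
Qed.

Let B := L + 2 * Num.sqrt alpha * Num.sqrt N / (1 - gamma).

Lemma denoised_error_mean k :
  avg k (fun t => `|denoised t k|) <=
  rho ^+ k * (2 / (1 - gamma)) + gamma * dmax d / (dmin d * (1 - gamma)) * B.
Proof.
set A := _ * B.
have dmax0 : 0 <= dmax d by rewrite (le_trans _ dmin_le_dmax)// ltW ?dmin_gt0.
have L0 : 0 <= L by rewrite divr_ge0 ?(ltW beta_gt0)// ln_ge0// card_ord ler1n.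
have B0 : 0 <= B.
  by rewrite addr_ge0// !mulr_ge0 ?sqrtr_ge0// invr_ge0 ltW.
have A0 : 0 <= A.
  by rewrite !mulr_ge0// invr_ge0 mulr_ge0 ?(ltW dmin_gt0) ?(ltW gamma_lt1).
elim: k => [|k IH].
  rewrite tuple_avg0 expr0 mul1r ler_wpDr//= /denoised_error/= subr0.
  rewrite (le_trans (ler_normB _ _))//.
  apply: (le_trans (lerD Q0_le1 optimal_qfun_norm_le)).
  (* The initial error is at most [1 + 1 / (1 - gamma)], and the 1 is absorbed into a second
     [1 / (1 - gamma)]. *)
  have : 1 <= (1 - gamma)^-1 by rewrite invf_ge1// gerBl.
  by move=> h; rewrite mulrC mulr_natr mulr2n lerD2r.
rewrite tuple_avgS.
apply: (@le_trans _ _ (avg k (fun t => rho * `|denoised t k| +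
    alpha * dmax d * gamma * (L + `|noise t k|)))).
  (* The one-step bound depends only on [t], hence holds uniformly in the last sample [x]. *)
  apply: le_tuple_avg => // t tk; apply: average_le => // x.
  have := denoised_error_step Q0 (nth x0 (rcons t x)) k alphaW gammaW beta_gt0
    d_ge0 d_le1 Qs_opt.
  rewrite [denoised_error _ _ _ _ _ _ _ _ k]/denoised_error.
  rewrite (eq_noise_iter _ _ _ _ _ _ (rcons_nth x tk)).
  by rewrite (eq_boltz_iter _ _ _ _ _ (rcons_nth x tk)).
rewrite tuple_avgD !tuple_avgZ tuple_avgD tuple_avg_cst//.
have h1 := ler_wpM2l rho_ge0 IH.
have h2 : alpha * dmax d * gamma * (L + avg k (fun t => `|noise t k|)) <=
    alpha * dmax d * gamma * B.
  by rewrite ler_wpM2l ?mulr_ge0// ?(ltW alpha_gt0)// lerD2l noise_iter_mean.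
apply: le_trans (lerD h1 h2) _.
(* [A] is the fixed point of the averaged recursion, because
   [1 - rho = alpha * dmin d * (1 - gamma)]. *)
rewrite le_eqVlt; apply/orP; left; apply/eqP; rewrite /A exprS; field.
by rewrite !gt_eqF ?dmin_gt0.
Qed.

(** The noise enters directly and through the forcing of the denoised error; [gamma * dmax d + (1 -
    gamma) * dmin d <= dmax d] merges the two contributions. *)
Lemma boltz_iter_error_mean k :
  avg k (fun t => `|iter t k - Qs|) <=
  rho ^+ k * (2 / (1 - gamma)) +
  gamma * dmax d / (dmin d * (1 - gamma)) * L +
  2 * Num.sqrt alpha * Num.sqrt N * dmax d / (dmin d * (1 - gamma) ^+ 2).
Proof.
apply: (@le_trans _ _ (avg k (fun t => `|denoised t k| + `|noise t k|))).
  apply: le_tuple_avg => // t _.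
  by rewrite /denoised_error -[leLHS](_ : `|(iter t k - Qs - noise t k) + noise t k| = _)
    ?ler_normD// subrK.
rewrite tuple_avgD; apply: le_trans (lerD (denoised_error_mean k) (noise_iter_mean k)) _.
rewrite -addrA -[leRHS]addrA lerD2l /B mulrDr -addrA lerD2l.
set s := 2 * Num.sqrt alpha * Num.sqrt N.
have s0 : 0 <= s by rewrite !mulr_ge0 ?sqrtr_ge0.
have -> : gamma * dmax d / (dmin d * (1 - gamma)) * (s / (1 - gamma)) + s / (1 - gamma) =
  s * (gamma * dmax d + (1 - gamma) * dmin d) / (dmin d * (1 - gamma) ^+ 2).
  by field; rewrite !gt_eqF ?dmin_gt0.
rewrite ler_wpM2r ?invr_ge0 ?mulr_ge0 ?exprn_ge0 ?(ltW dmin_gt0) ?(ltW gamma_lt1)//.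
rewrite ler_wpM2l//.
have := ler_wpM2l (ltW gamma_lt1) dmin_le_dmax; lra.
Qed.

(** The first summand on the right is nonnegative ([t1]), and the other three dominate those of the
    sharper bound one by one ([t2], [t3], [t4]). *)
Lemma boltz_iter_error_bound k :
  avg k (fun t => `|iter t k - Qs|) <=
  4 * alpha * gamma * dmax d * N / (1 - gamma) * k%:R * rho ^+ k.-1
  + 3 * Num.sqrt 6 * alpha `^ (1 / 2) * dmax d * (ln #|action m|%:R + beta)
    * N `^ (1 / 2) / (beta * dmin d `^ (3 / 2) * (1 - gamma) `^ (5 / 2))
  + 4 * dmax d * ln #|action m|%:R * N `^ (1 / 2)
    / (beta * dmin d ^+ 2 * (1 - gamma) ^+ 2)
  + 2 * N / (1 - gamma) * rho ^+ k.
Proof.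
apply: le_trans (boltz_iter_error_mean k) _.
have g1 : 1 - gamma <= 1 by rewrite gerBl.
have dmin0 := dmin_gt0.
have dmax0 : 0 < dmax d by exact: lt_le_trans dmin_gt0 dmin_le_dmax.
have N1 : 1 <= N.
  by rewrite ler1n; apply/card_gt0P; exists (ord0, ord0).
have sN1 : 1 <= Num.sqrt N by rewrite -[leLHS]sqrtr1 ler_wsqrtr.
have lnA : 0 <= ln #|action m|%:R :> R by rewrite ln_ge0// card_ord ler1n.
rewrite !div1r !powR12_sqrt ?(ltW alpha_gt0) ?(le_trans ler01 N1)//.
have t1 : 0 <= 4 * alpha * gamma * dmax d * N / (1 - gamma) * k%:R * rho ^+ k.-1.
  by rewrite !mulr_ge0 ?exprn_ge0 ?rho_ge0 ?invr_ge0 ?(ltW alpha_gt0) ?(ltW dmax0)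
    ?(ltW gamma_lt1).
have t4 : rho ^+ k * (2 / (1 - gamma)) <= 2 * N / (1 - gamma) * rho ^+ k.
  rewrite mulrC ler_wpM2r ?exprn_ge0 ?rho_ge0// ler_wpM2r ?invr_ge0 ?(ltW gamma_lt1)//.
  by rewrite ler_peMr.
have t3 : gamma * dmax d / (dmin d * (1 - gamma)) * L <=
    4 * dmax d * ln #|action m|%:R * Num.sqrt N / (beta * dmin d ^+ 2 * (1 - gamma) ^+ 2).
  set l := ln _ in lnA *.
  (* With the common factor taken out, there remains [gamma * (dmin d * (1 - gamma)) <= 1 <= 4 *
     Num.sqrt N]. *)
  have -> : gamma * dmax d / (dmin d * (1 - gamma)) * (l / beta) =
    (dmax d * l / (beta * dmin d ^+ 2 * (1 - gamma) ^+ 2)) *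
    (gamma * (dmin d * (1 - gamma))).
    by field; rewrite !gt_eqF.
  have -> : 4 * dmax d * l * Num.sqrt N / (beta * dmin d ^+ 2 * (1 - gamma) ^+ 2) =
    (dmax d * l / (beta * dmin d ^+ 2 * (1 - gamma) ^+ 2)) * (4 * Num.sqrt N).
    by field; rewrite !gt_eqF.
  rewrite ler_wpM2l//.
    by rewrite divr_ge0 ?mulr_ge0 ?exprn_ge0// ltW.
  apply: (@le_trans _ _ 1); last lra.
  have dg1 : dmin d * (1 - gamma) <= 1.
    by rewrite mulr_ile1 ?dmin_le1// ltW.
  have /andP[_ gle1] := gammaW.
  by rewrite mulr_ile1// mulr_ge0// ltW.
have t2 : 2 * Num.sqrt alpha * Num.sqrt N * dmax d / (dmin d * (1 - gamma) ^+ 2) <=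
    3 * Num.sqrt 6 * Num.sqrt alpha * dmax d * (ln #|action m|%:R + beta) * Num.sqrt N /
    (beta * dmin d `^ (3 / 2) * (1 - gamma) `^ (5 / 2)).
  set l := ln _ in lnA *; set p := dmin d `^ _; set q := (1 - gamma) `^ _.
  have p0 : 0 < p by exact: powR_gt0.
  have q0 : 0 < q by exact: powR_gt0.
  (* Both bases lie in [(0, 1]], so raising the exponents from 1 to 3/2 and from 2 to 5/2 shrinks
     the denominators. *)
  have pd : p <= dmin d.
    rewrite -[leRHS]powRr1 ?(ltW dmin0)// ger_powR ?dmin0 ?dmin_le1//; lra.
  have qg : q <= (1 - gamma) ^+ 2.
    rewrite -powR_mulrn ?(ltW gamma_lt1)// ger_powR ?gamma_lt1//; lra.
  have s6 : 1 <= Num.sqrt 6 :> R.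
    by rewrite -[leLHS]sqrtr1 ler_wsqrtr// ler1n.
  have -> : 3 * Num.sqrt 6 * Num.sqrt alpha * dmax d * (l + beta) * Num.sqrt N /
      (beta * p * q) =
    (Num.sqrt alpha * Num.sqrt N * dmax d / (p * q)) *
    (3 * Num.sqrt 6 * (l / beta + 1)).
    by field; rewrite !gt_eqF.
  have -> : 2 * Num.sqrt alpha * Num.sqrt N * dmax d / (dmin d * (1 - gamma) ^+ 2) =
    (Num.sqrt alpha * Num.sqrt N * dmax d / (dmin d * (1 - gamma) ^+ 2)) * 2.
    by field; rewrite !gt_eqF.
  have num0 : 0 <= Num.sqrt alpha * Num.sqrt N * dmax d.
    by rewrite !mulr_ge0 ?sqrtr_ge0// ltW.
  apply: ler_pM => //.
  - by rewrite divr_ge0// mulr_ge0 ?exprn_ge0// ltW.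
  - rewrite ler_wpM2l// lef_pV2 ?posrE ?mulr_gt0 ?exprn_gt0//.
    by rewrite ler_pM// ltW.
  - apply: (@le_trans _ _ (3 * 1)); first lra.
    rewrite ler_pM//; first lra.
    by rewrite lerDr divr_ge0// ltW.
lra.
Qed.

End MeanError.

Theorem theorem5p2 (R : realType) (n m : nat) (M : mdp R n m)
    (disp : measure_display) (T : measurableType disp) (P : probability T R)
    (d : state n * action m -> R) (X : nat -> T -> sample n m)
    (alpha beta gamma : R) (Q0 Qstar : qfun R n m)
    (hr : forall s a s', `|reward M s a s'| <= 1)
    (hgamma : 0 <= gamma < 1)
    (halpha : 0 < alpha < 1)
    (hbeta : 0 < beta)
    (hd : sa_distribution d)
    (hdpos : forall x, 0 < d x)
    (hX : iid_sampling P M d X)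
    (hQ0 : `|Q0| <= 1)
    (hQstar : optimal_qfun M gamma Qstar)
    (k : nat) :
  let Q := fun (j : nat) (w : T) =>
    boltz_iter M alpha beta gamma Q0 (fun i => X i w) j in
  let nA : R := #|action m|%:R in
  let nSA : R := #|{: state n * action m}|%:R in
  let rho : R := 1 - alpha * dmin d * (1 - gamma) in
  ('E_P[fun w => `|Q k w - Qstar|%R] <=
   (4 * alpha * gamma * dmax d * nSA / (1 - gamma) * k%:R * rho ^+ k.-1
    + 3 * Num.sqrt 6 * alpha `^ (1 / 2) * dmax d * (ln nA + beta) * nSA `^ (1 / 2)
      / (beta * dmin d `^ (3 / 2) * (1 - gamma) `^ (5 / 2))
    + 4 * dmax d * ln nA * nSA `^ (1 / 2)
      / (beta * dmin d ^+ 2 * (1 - gamma) ^+ 2)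
    + 2 * nSA / (1 - gamma) * rho ^+ k)%R%:E)%E.
Proof.
cbv zeta; case: hX => mX lawSA lawX indepX; case: hd => _ d1.
pose x0 : sample n m := (ord0, ord0, ord0).
(* The trajectory is replaced by the list of its first [k] samples, continued by [x0], so that
   [expectation_tuple] applies. *)
have -> : (fun w => `|boltz_iter M alpha beta gamma Q0 (X^~ w) k - Qstar|) =
    (fun w => `|boltz_iter M alpha beta gamma Q0 (nth x0 (mkseq (X^~ w) k)) k - Qstar|).
  apply/funext => w; congr (`|_ - _|); apply: eq_boltz_iter => i ik.
  by rewrite nth_mkseq.
(* The marginal of the pair times the conditional law of the next state gives the law of the whole
   triple. *)
have law k' x : P (X k' @^-1` [set x]) = (sample_weight M d x)%:E.
  case: x => [[s a] s']; rewrite /sample_weight/= EFinM -(lawSA k') -lawX.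
  congr (P _); apply/seteqP; split => w /=; first by move=> ->.
  by case: (X k' w) => [y y'] /= [-> ->].
rewrite (expectation_tuple x0 mX law indepX k
  (fun t => normr_ge0 (boltz_iter M alpha beta gamma Q0 (nth x0 t) k - Qstar))) lee_fin.
exact: boltz_iter_error_bound.
Qed.
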